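(* Let $d\ge 1$ be an integer and let $G=(V,E)$ be a finite simple graph with at least $d+1$ vertices. If $G$ admits a $d$-rigid partition, then $G$ is $d$-rigid.
   Context: For an embedding $\mathbf p:V\to\mathbb R^d$, the rigidity matrix $\mathsf R(G,\mathbf p)\in\mathbb R^{|E|\times d|V|}$ has rows indexed by edges and $d$ columns per vertex; the row of $e=\{u,v\}$ equals $\mathbf p(u)-\mathbf p(v)$ in the columns of $u$, $\mathbf p(v)-\mathbf p(u)$ in the columns of $v$, and $0$ elsewhere. Its rank is always at most $d|V|-\binom{d+1}{2}$ (for $|V|\ge d+1$). $G$ is called $d$-rigid if there is an embedding $\mathbf p$ with $\operatorname{rank}\mathsf R(G,\mathbf p)=d|V|-\binom{d+1}{2}$ (equivalently, generic frameworks of $G$ in $\mathbb R^d$ are rigid). Pairwise disjoint sets $V_1,\dots,V_k$ form a colouring of $V$ if their union is $V$ (empty sets allowed), and a partial colouring if their union is contained in $V$; similarly for edge sets. For a partial colouring $\{E_{ij}\}$ of $E$ with $\hat E=\bigcup E_{ij}$, a set $U\subseteq V$ has a monochromatic cut if there is a partition $U=U'\cup U''$ into two nonempty sets such that $\hat E\cap E(U',U'')$ is contained in a single colour class $E_{ij}$, where $E(A,B)$ is the set of edges with one endpoint in $A$ and the other in $B$. A $d$-rigid partition of $G$ is a pair $(\{V_i\}_{i=1}^{d+1},\{E_{ij}\}_{1\le i<j\le d+1})$ where $V_1,\dots,V_{d+1}$ is a colouring of $V$ and $\{E_{ij}\}$ is a partial colouring of $E$ such that every $e\in E_{ij}$ satisfies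 $e\subseteq V_i\cup V_j$, each graph $G_{ij}=(V_i\cup V_j,E_{ij})$ is connected (a graph with no vertices counts as disconnected), and for every $1\le i\le d+1$ every $U\subseteq V_i$ with $|U|\ge 2$ has a monochromatic cut. *)

(* Defs.v *)
From mathcomp Require Import all_boot all_order all_algebra.
From mathcomp Require Import reals.

Set Implicit Arguments.
Unset Strict Implicit.
Unset Printing Implicit Defensive.

Import GRing.Theory.
Local Open Scope ring_scope.

Record sgraph (V : finType) := SGraph {
  edges : {set {set V}};
  edges_card2 : forall e, e \in edges -> #|e| = 2%N }.

(** Rigidity *)

Section Rigidity.
Variables (R : realType) (d : nat) (V : finType) (G : sgraph V).

(* For e = {u, v} the inner sum has the single term p u - p v when w = u,
   the single term p v - p u when w = v.  [mxvec] lists the d columns of each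
   vertex consecutively. *)
Definition rigidity_row (p : V -> 'rV[R]_d) (e : {set V}) : 'rV[R]_(#|V| * d) :=
  mxvec (\matrix_(i < #|V|)
    let w := enum_val i in
    if w \in e then \sum_(w' in e :\ w) (p w - p w') else 0).

Definition rigidity_matrix (p : V -> 'rV[R]_d) : 'M[R]_(#|edges G|, #|V| * d) :=
  \matrix_(k < #|edges G|) rigidity_row p (enum_val k).

(* Meaningful for d + 1 <= #|V|; the natural-number subtraction is then not
   truncated. *)
Definition d_rigid : Prop :=
  exists2 p : V -> 'rV[R]_d, injective p &
    \rank (rigidity_matrix p) = (d * #|V| - 'C(d.+1, 2))%N.

End Rigidity.

(** Rigid partitions *)

Definition pairwise_disjoint (I T : finType) (C : I -> {set T}) : Prop :=
  forall i j, i != j -> [disjoint C i & C j].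

Definition colouring (I T : finType) (A : {set T}) (C : I -> {set T}) : Prop :=
  pairwise_disjoint C /\ \bigcup_i C i = A.

Definition partial_colouring (I T : finType) (A : {set T}) (C : I -> {set T}) :
    Prop :=
  pairwise_disjoint C /\ \bigcup_i C i \subset A.

Section RigidPartition.
Variables (V : finType) (G : sgraph V).

Definition edges_between (A B : {set V}) : {set {set V}} :=
  [set e in edges G | [exists u in A, exists v in B, e == [set u; v]]].

Definition has_monochromatic_cut (K : finType) (E_ : K -> {set {set V}})
    (U : {set V}) : Prop :=
  exists U1 U2 : {set V},
    [/\ U1 != set0, U2 != set0, [disjoint U1 & U2], U1 :|: U2 = U &
        exists k : K, (\bigcup_k' E_ k') :&: edges_between U1 U2 \subset E_ k].

(* Connectedness of the graph with vertex set U and edge set F. *)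
Definition graph_connected (U : {set V}) (F : {set {set V}}) : Prop :=
  U != set0 /\
  forall u v, u \in U -> v \in U ->
    connect [rel x y | [&& x \in U, y \in U & [set x; y] \in F]] u v.

Definition colour_pair (d : nat) := {ij : 'I_d.+1 * 'I_d.+1 | (ij.1 < ij.2)%N}.

Definition rigid_partition (d : nat) (V_ : 'I_d.+1 -> {set V})
    (E_ : colour_pair d -> {set {set V}}) : Prop :=
  [/\ colouring [set: V] V_,
      partial_colouring (edges G) E_,
      forall k e, e \in E_ k -> e \subset V_ (val k).1 :|: V_ (val k).2,
      forall k, graph_connected (V_ (val k).1 :|: V_ (val k).2) (E_ k) &
      forall i (U : {set V}), U \subset V_ i -> (2 <= #|U|)%N ->
        has_monochromatic_cut E_ U].

End RigidPartition.

(* Main.v *)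
(* Let x_0, ..., x_d be the vertices of a simplex.  Place the vertices of V_i at
   polynomial positions in t that tend to x_i as t -> 0: splitting V_i along a
   monochromatic cut of colour E_kl, move one side by x_k - x_l relative to the
   other, and recurse on both sides at scale t.  Then every edge of E_kl, after
   division of its row by a power of t, has at t = 0 the direction x_k - x_l.
   Connectedness of the graphs G_kl bounds the corank of these limit rows by
   'C(d+1, 2), and rank is lower semicontinuous, so the rank is large enough for
   all but finitely many t.  The matching upper bound comes from 'C(d+1, 2)
   infinitesimal isometries, independent at t = 0 and hence for generic t. *)

Require Import Defs.
From mathcomp Require Import all_boot all_order all_algebra.
From mathcomp Require Import reals.

Set Implicit Arguments.
Unset Strict Implicit.
Unset Printing Implicit Defensive.

Import GRing.Theory Num.Theory.
Local Open Scope ring_scope.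

(** * Rows attached to an edge and a vector *)

Section EdgeRows.
Variables (A : comNzRingType) (V : finType) (d : nat).
Implicit Types (u v : V) (g : 'rV[A]_d) (Y : 'M[A]_(#|V|, d)).

Definition vertex_row u : 'rV[A]_#|V| := delta_mx 0 (enum_rank u).

(** The tensor of the oriented incidence vector of [uv] with a free vector [g]: a rigidity row when
    [g] is [p u - p v], but also available for limit directions. *)
Definition edge_row u v g : 'rV[A]_(#|V| * d) :=
  mxvec ((vertex_row u - vertex_row v)^T *m g).

Lemma edge_rowZ u v a g : edge_row u v (a *: g) = a *: edge_row u v g.
Proof. by rewrite /edge_row -scalemxAr linearZ. Qed.

Lemma edge_row_dot u v g Y :
  edge_row u v g *m (mxvec Y)^T =
    (row (enum_rank u) Y - row (enum_rank v) Y) *m g^T.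
Proof. by rewrite /edge_row mxvec_dotmul mulmxBl -!rowE. Qed.

End EdgeRows.

Lemma map_edge_row (A B : comNzRingType) (f : {rmorphism A -> B}) (V : finType)
    (d : nat) (u v : V) (g : 'rV[A]_d) :
  map_mx f (edge_row u v g) = edge_row u v (map_mx f g).
Proof.
by rewrite /edge_row map_mxvec map_mxM -map_trmx map_mxB /vertex_row !map_delta_mx.
Qed.

Lemma rigidity_row_pair (R : realType) (d : nat) (V : finType)
    (p : V -> 'rV[R]_d) (u v : V) :
  u != v -> rigidity_row p [set u; v] = edge_row u v (p u - p v).
Proof.
move=> uv; congr mxvec; apply/row_matrixP => i; rewrite row_mul rowK.
rewrite -[i]enum_valK; set w := enum_val i; rewrite enum_rankK /= !inE.
have -> : row (enum_rank w) (vertex_row R u - vertex_row R v)^T =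
    ((w == u)%:R - (w == v)%:R)%:M.
  apply/matrixP => j k; rewrite !ord1 !mxE /= mulr1n.
  by rewrite !(inj_eq enum_rank_inj).
rewrite mul_scalar_mx; case: (eqVneq w u) => [-> | wu] /=.
  rewrite (negbTE uv) subr0 scale1r (_ : _ :\ u = [set v]) ?big_set1 //.
  by apply/setP=> x; rewrite !inE; case: (eqVneq x u) => [->|] //=; rewrite (negbTE uv).
case: (eqVneq w v) => [-> | wv] /=; last by rewrite subr0 scale0r.
rewrite sub0r scaleN1r opprB (_ : _ :\ v = [set u]) ?big_set1 //.
by apply/setP=> x; rewrite !inE; case: (eqVneq x v) => [->|] //=; rewrite ?orbF // eq_sym (negbTE uv).
Qed.

(** * Barycentric coordinates and infinitesimal isometries of the simplex *)

Section Simplex.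
Variables (A : comNzRingType) (d : nat).
Implicit Types (a i j : 'I_d.+1) (p q : 'rV[A]_d) (k : colour_pair d).

(* The last vertex is the origin; accordingly the last barycentric coordinate
   is 1 minus the sum of the coordinates. *)
Definition simplex_vertex i : 'rV[A]_d := \row_j (i == j :> nat)%:R.

Definition bary_grad a : 'rV[A]_d :=
  \row_j ((a == j :> nat)%:R - (a == d :> nat)%:R).

Definition bary a p : A := (bary_grad a *m p^T) 0 0 + (a == d :> nat)%:R.

Definition direction k : 'rV[A]_d :=
  simplex_vertex (val k).1 - simplex_vertex (val k).2.

(* An infinitesimal isometry for each edge of the simplex, dual to the edge
   directions: only along the edge [k] itself do the ends of an edge have a
   nonzero velocity component under [motion k] (see [motion_direction]). *)
Definition motion k p : 'rV[A]_d :=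
  bary (val k).1 p *: bary_grad (val k).2 -
  bary (val k).2 p *: bary_grad (val k).1.

Lemma baryB a p q : bary a p - bary a q = (bary_grad a *m (p - q)^T) 0 0.
Proof. by rewrite /bary opprD addrACA subrr addr0 linearB mulmxBr !mxE. Qed.

Lemma bary_vertex a i : bary a (simplex_vertex i) = (a == i)%:R.
Proof.
rewrite /bary mxE; have [id|di] := ltnP i d.
  rewrite (bigD1 (Ordinal id)) //= big1 => [|j ji]; rewrite !mxE /= ?eqxx.
    by rewrite addr0 mulr1 subrK.
  rewrite (_ : (i == j :> nat) = false) ?mulr0 //.
  by apply: contraNF ji => /eqP ij; apply/eqP/val_inj.
have eid : i = d :> nat by apply/eqP; rewrite eqn_leq di -ltnS ltn_ord.
rewrite big1 ?add0r => [|j _]; first by rewrite -val_eqE /= eid.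
by rewrite !mxE eid (gtn_eqF (ltn_ord j)) mulr0.
Qed.

(** The linear part of a motion is skew: it sends [x] to [(g1 . x) g2 - (g2 . x) g1] for two
    gradients [g1], [g2], and pairing with [x] gives two equal products that cancel. *)
Lemma motion_orthogonal k p q :
  (motion k p - motion k q) *m (p - q)^T = 0.
Proof.
rewrite /motion opprD addrACA -opprD -!scalerBl !baryB mulmxBl -!scalemxAl.
apply/matrixP => x y; rewrite !ord1 ![in LHS]mxE.
by rewrite [X in _ - X]mulrC subrr mxE.
Qed.

Lemma motion_direction k k' i :
  i \in [:: (val k).1; (val k).2] ->
  motion k' (simplex_vertex i) *m (direction k)^T = - (k' == k)%:R%:M.
Proof.
move: k k' => [[x y] /= xy] [[a b] /= ab] ixy.
have grad_dir c : bary_grad c *m (direction (exist _ (x, y) xy))^T =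
    ((c == x)%:R - (c == y)%:R)%:M.
  apply/matrixP => r s; rewrite !ord1 -baryB !bary_vertex.
  by rewrite mxE eqxx mulr1n.
rewrite /motion /= mulmxBl -!scalemxAl !grad_dir !bary_vertex !scale_scalar_mx.
rewrite -raddfB -raddfN /=; congr _%:M.
rewrite -[_ == exist _ _ _]val_eqE /= xpair_eqE; move: ixy ab (xy); rewrite !inE -!val_eqE /=.
(* The reversed match [a = y], [b = x] would contribute with the opposite sign; [a < b] and [x < y]
   exclude it. *)
case/orP=> /eqP-> ab' xy'.
  case: (eqVneq (b : nat) x) => [bx|_]; last first.
    by rewrite mul0r subr0 sub0r mulrN -natrM mulnb.
  have ax : (a < x)%N by rewrite -bx.
  rewrite (ltn_eqF ax) (ltn_eqF (ltn_trans ax xy')) /=.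
  by rewrite !(mul0r, subr0, mulr0, oppr0).
case: (eqVneq (a : nat) y) => [ay|_]; last first.
  by rewrite mul0r sub0r subr0 -natrM mulnb andbC.
have yb : (y < b)%N by rewrite -ay.
rewrite (gtn_eqF yb) (gtn_eqF (ltn_trans xy' yb)) ay (gtn_eqF xy') /=.
by rewrite !(mul0r, subr0, mulr0, oppr0).
Qed.

(** Orthogonality to the edges at [i] gives [p] the same product with every simplex vertex. One
    vertex is the origin, so all these products vanish, and the others are the coordinates of
    [p]. *)
Lemma simplex_span i p :
  (forall k, i \in [:: (val k).1; (val k).2] -> p *m (direction k)^T = 0) ->
  p = 0.
Proof.
move=> orth; have eqi j : p *m (simplex_vertex j)^T = p *m (simplex_vertex i)^T.
  have dir (a b : 'I_d.+1) (ab : (a < b)%N) : i \in [:: a; b] ->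
      p *m (simplex_vertex a)^T = p *m (simplex_vertex b)^T.
    move=> iab; apply/eqP; rewrite -subr_eq0 -mulmxBr -linearB /=.
    exact/eqP/(orth (exist _ (a, b) ab)).
  have [ij|ji|/val_inj -> //] := ltngtP i j.
    by rewrite (dir i j) // inE eqxx.
  by rewrite (dir j i) // !inE eqxx orbT.
have max0 : simplex_vertex ord_max = 0.
  by apply/matrixP => x y; rewrite !mxE gtn_eqF.
have {}eqi j : p *m (simplex_vertex j)^T = 0.
  by rewrite eqi -(eqi ord_max) max0 trmx0 mulmx0.
apply/matrixP => x j; rewrite !ord1 [RHS]mxE.
have /matrixP/(_ 0 0) := eqi (widen_ord (leqnSn d) j).
rewrite mxE (bigD1 j) //= big1 => [|a aj]; rewrite !mxE /=.
  by rewrite eqxx mulr1 addr0.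
rewrite (_ : (j == a :> nat) = false) ?mulr0 //.
by apply: contraNF aj => /eqP ja; apply/eqP/val_inj.
Qed.

End Simplex.

Section MapSimplex.
Variables (A B : comNzRingType) (f : {rmorphism A -> B}) (d : nat).

Lemma map_simplex_vertex (i : 'I_d.+1) :
  map_mx f (simplex_vertex A i) = simplex_vertex B i.
Proof. by apply/matrixP => x y; rewrite !mxE rmorph_nat. Qed.

Lemma map_motion (k : colour_pair d) (p : 'rV[A]_d) :
  map_mx f (motion k p) = motion k (map_mx f p).
Proof.
have mapg a : map_mx f (bary_grad A a) = bary_grad B a.
  by apply/matrixP => x y; rewrite !mxE rmorphB !rmorph_nat.
have mapb a : f (bary a p) = bary a (map_mx f p).
  by rewrite /bary rmorphD rmorph_nat -mapg map_trmx -map_mxM [in RHS]mxE.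
by rewrite /motion map_mxB !map_mxZ !mapb !mapg.
Qed.

End MapSimplex.

Lemma simplex_vertex_inj (A : comNzRingType) (d : nat) :
  injective (@simplex_vertex A d).
Proof.
move=> i j /(congr1 (bary i)); rewrite !bary_vertex eqxx.
by case: eqP => // _ /eqP; rewrite oner_eq0.
Qed.

Lemma direction_neq0 (A : comNzRingType) (d : nat) (k : colour_pair d) :
  direction A k != 0.
Proof.
rewrite subr_eq0; apply/eqP => /simplex_vertex_inj k12.
by case: k k12 => -[a b] /= + ab; rewrite ab ltnn.
Qed.

Lemma card_colour_pair (d : nat) : #|{: colour_pair d}| = 'C(d.+1, 2).
Proof.
rewrite card_sig -bin2_sum big_mkord -sum1_card.
rewrite (eq_bigl (fun ij : 'I_d.+1 * 'I_d.+1 => (ij.1 < ij.2)%N)) //.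
rewrite -(pair_big_dep xpredT (fun i j : 'I_d.+1 => (i < j)%N) (fun _ _ => 1%N)) /=.
rewrite (exchange_big_dep xpredT) //=; apply: eq_bigr => i _.
by rewrite (big_ord_narrow (ltnW (ltn_ord i))) sum_nat_const card_ord muln1.
Qed.

(** * Generic values of t and semicontinuity of rank *)

Section NearZero.
Variable F : numDomainType.

(** The exceptions lie among 0 and the roots of [q]. Nonvanishing at 0 certifies that [q] is nonzero
    and survives products, hence finite conjunctions. *)
Definition near0 (P : F -> Prop) : Prop :=
  exists2 q : {poly F}, q.[0] != 0 & forall t, t != 0 -> q.[t] != 0 -> P t.

Lemma near0_forall (I : finType) (P : I -> F -> Prop) :
  (forall i, near0 (P i)) -> near0 (fun t => forall i, P i t).
Proof.
move=> nP; have /fin_all_exists[q qP] i : exists q : {poly F},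
    q.[0] != 0 /\ forall t, t != 0 -> q.[t] != 0 -> P i t.
  by have [q q0 qP] := nP i; exists q.
exists (\prod_i q i) => [|t t0 qt i].
  by rewrite horner_prod prodf_seq_neq0; apply/allP => i _; have [] := qP i.
have [_] := qP i; apply=> //; move: qt; rewrite horner_prod (bigD1 i) //=.
by rewrite mulf_eq0 negb_or => /andP[].
Qed.

Lemma near0_and (P Q : F -> Prop) :
  near0 P -> near0 Q -> near0 (fun t => P t /\ Q t).
Proof.
move=> [p p0 pP] [q q0 qQ]; exists (p * q) => [|t t0].
  by rewrite hornerM mulf_neq0.
by rewrite hornerM mulf_eq0 negb_or => /andP[pt qt]; split; [apply: pP | apply: qQ].
Qed.

Lemma near0_imply (P Q : F -> Prop) :
  (forall t, t != 0 -> P t -> Q t) -> near0 P -> near0 Q.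
Proof. by move=> PQ [p p0 pP]; exists p => // t t0 pt; apply: PQ => //; apply: pP. Qed.

(** A nonzero polynomial has fewer roots than its size, and the naturals embed in [F]; the factor
    ['X] also rules out 0. *)
Lemma near0_exists (P : F -> Prop) : near0 P -> exists2 t, t != 0 & P t.
Proof.
case=> q q0 qP; pose r := 'X * q; pose s : seq F := [seq i%:R | i <- iota 0 (size r)].
have r0 : r != 0.
  by rewrite mulf_neq0 ?polyX_eq0 //; apply: contraNneq q0 => ->; rewrite horner0.
have : ~~ all (root r) s.
  apply/negP => /(max_poly_roots r0); rewrite size_map size_iota ltnn => H.
  suff /H : uniq s by [].
  by rewrite map_inj_uniq ?iota_uniq // => a b /eqP; rewrite eqr_nat => /eqP.
rewrite -has_predC => /hasP[t _ /=]; rewrite /root /r hornerM hornerX mulf_eq0 negb_or.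
by case/andP=> t0 qt; exists t => //; apply: qP.
Qed.

End NearZero.

Notation eval_mx t := (map_mx (horner_eval t)).

(* If [L *m M(0) *m N = 1] with constant [L] and [N], then the polynomial
   [\det (L *m M(t) *m N)] is nonzero at 0. *)
Lemma near0_rank (F : numFieldType) (m n : nat) (M : 'M[{poly F}]_(m, n)) :
  near0 (fun t => (\rank (eval_mx 0 M) <= \rank (eval_mx t M))%N).
Proof.
set M0 := eval_mx 0 M; pose L := pinvmx (col_base M0); pose N := pinvmx (row_base M0).
have LMN : L *m M0 *m N = 1%:M.
  rewrite -[M0 in L *m M0]mulmx_base mulmxA mulVpmx ?col_base_full // mul1mx.
  by rewrite mulmxVp ?row_base_free.
have evC t p q (X : 'M[F]_(p, q)) : eval_mx t (map_mx polyC X) = X.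
  by apply/matrixP => i j; rewrite !mxE horner_evalE hornerC.
pose Q := map_mx polyC L *m M *m map_mx polyC N.
have evQ t : (\det Q).[t] = \det (L *m eval_mx t M *m N).
  by rewrite -horner_evalE -det_map_mx !map_mxM !evC.
exists (\det Q) => [|t _]; first by rewrite evQ LMN det1 oner_neq0.
rewrite evQ -unitfE -unitmxE -row_free_unit => /eqP <-.
by rewrite (leq_trans (mxrankM_maxl _ _)) ?mxrankM_maxr.
Qed.

(** * Lower bound on the rank of the limit rows *)

Section LowerBound.
Variables (F : fieldType) (V : finType) (G : sgraph V) (d : nat).
Variables (V_ : 'I_d.+1 -> {set V}) (E_ : colour_pair d -> {set {set V}}).
Hypothesis part : @rigid_partition V G d V_ E_.

Let bin := #|{: colour_pair d}|.

(* A velocity field in the kernel of [W] has, on [V_ i :|: V_ j], a constant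
   component along the direction [k = (i, j)], by connectedness.  Imposing that
   these 'C(d+1, 2) constants vanish kills the whole kernel. *)
Lemma rank_limit_rows (m : nat) (W : 'M[F]_(m, #|V| * d)) :
  (forall Y, W *m (mxvec Y)^T = 0 -> forall k u v, [set u; v] \in E_ k ->
    (row (enum_rank u) Y - row (enum_rank v) Y) *m (direction F k)^T = 0) ->
  (#|V| * d <= \rank W + bin)%N.
Proof.
case: part => -[_ covV] _ _ conn _ kerW.
have /fin_all_exists[r rP] (k : colour_pair d) : exists v, v \in V_ (val k).1 :|: V_ (val k).2.
  by have [/set0Pn] := conn k.
(* Row [k] reads the velocity component along [direction F k] at one base vertex of the graph of
   colour [k]. Stacking [Phi] under [W] adds at most [bin] to the rank. *)
pose Phi : 'M[F]_(bin, #|V| * d) :=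
  \matrix_k mxvec ((vertex_row F (r (enum_val k)))^T *m direction F (enum_val k)).
suff full : \rank (col_mx W Phi) = (#|V| * d)%N.
  rewrite -[X in (X <= _)%N]full -addsmxE.
  by rewrite (leq_trans (mxrank_adds_leqif _ _)) // leq_add2l rank_leq_row.
rewrite -mxrank_tr; apply/eqP/inj_row_free => y; rewrite -[y]vec_mxK.
set Y := vec_mx y => /(congr1 trmx); rewrite trmx_mul trmxK trmx0 mul_col_mx.
move=> /eqP; rewrite col_mx_eq0 => /andP[/eqP WY /eqP PhiY].
have rY k : row (enum_rank (r k)) Y *m (direction F k)^T = 0.
  have /(congr1 (row (enum_rank k))) := PhiY.
  by rewrite row0 row_mul rowK mxvec_dotmul -rowE enum_rankK.
have VY k u : u \in V_ (val k).1 :|: V_ (val k).2 ->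
    row (enum_rank u) Y *m (direction F k)^T = 0.
  move=> uk; have [_ /(_ _ _ (rP k) uk)/connectP[s]] := conn k.
  have := rY k; move: (r k) => x; elim: s x => [|z s IHs] x xY /= => [_ -> //|].
  case/andP=> /and3P[_ _ xz] zs us; apply: IHs zs us.
  by apply/eqP; rewrite -xY eq_sym -subr_eq0 -mulmxBl (kerW _ WY).
rewrite (_ : Y = 0) ?linear0 //; apply/row_matrixP => w; rewrite row0.
rewrite -[w]enum_valK; set u := enum_val w.
have /bigcupP[i _ ui] : u \in \bigcup_i V_ i by rewrite covV inE.
(* A vertex of [V_ i] lies in the graph of every colour whose pair contains [i]. *)
apply: (simplex_span (i := i)) => k ki; apply: VY; rewrite inE.
by move: ki; rewrite !inE => /orP[]/eqP<-; rewrite ui ?orbT.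
Qed.

End LowerBound.

(** * Upper bound from infinitesimal isometries *)

Section UpperBound.
Variables (V : finType) (d : nat).

Definition motions (A : comNzRingType) (p : V -> 'rV[A]_d) :
    'M[A]_(#|{: colour_pair d}|, #|V| * d) :=
  \matrix_k mxvec (\matrix_(i < #|V|) motion (enum_val k) (p (enum_val i))).

Lemma map_motions (A B : comNzRingType) (f : {rmorphism A -> B})
    (p : V -> 'rV[A]_d) :
  map_mx f (motions p) = motions (fun v => map_mx f (p v)).
Proof.
apply/row_matrixP => k; rewrite -map_row !rowK map_mxvec; congr mxvec.
by apply/row_matrixP => i; rewrite -map_row !rowK map_motion.
Qed.

(** Evaluation at the points [r k], paired with the edge directions, is dual to the motions up to
    sign by [motion_direction]; this gives independent rows. *)
Lemma rank_motions (F : fieldType) (p : V -> 'rV[F]_d) (r : colour_pair d -> V) :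
  (forall k, exists2 i, i \in [:: (val k).1; (val k).2] &
     p (r k) = simplex_vertex F i) ->
  \rank (motions p) = #|{: colour_pair d}|.
Proof.
move=> pr; pose Phi : 'M[F]_(#|{: colour_pair d}|, #|V| * d) :=
  \matrix_k mxvec ((vertex_row F (r (enum_val k)))^T *m direction F (enum_val k)).
have PhiM : Phi *m (motions p)^T = - 1%:M.
  apply/row_matrixP => b; rewrite row_mul; apply: trmx_inj; rewrite trmx_mul trmxK.
  apply/row_matrixP => a; rewrite row_mul; apply: trmx_inj; rewrite trmx_mul trmxK.
  rewrite !rowK mxvec_dotmul -rowE rowK enum_rankK.
  have [i ik ->] := pr (enum_val b).
  rewrite motion_direction // (inj_eq enum_val_inj).
  by apply/matrixP => x y; rewrite !ord1 !mxE eqxx mulr1n eq_sym.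
apply/eqP/row_freeP; exists (- Phi^T).
by rewrite mulmxN -[motions p]trmxK -trmx_mul PhiM linearN /= trmx1 opprK.
Qed.

Lemma rank_rigidity_motions (R : realType) (G : sgraph V) (p : V -> 'rV[R]_d) :
  (\rank (rigidity_matrix G p) + \rank (motions p) <= #|V| * d)%N.
Proof.
rewrite -(mxrank_tr (motions p)); apply: mulmx0_rank_max.
apply/row_matrixP => e; rewrite row_mul rowK row0.
have /edges_card2/eqP/cards2P[u [v [uv ->]]] := enum_valP e.
rewrite rigidity_row_pair //; apply: trmx_inj; rewrite trmx_mul trmxK trmx0.
apply/row_matrixP => k; rewrite row_mul rowK row0; apply: trmx_inj.
rewrite trmx_mul trmxK trmx0 edge_row_dot !rowK !enum_rankK.
exact: motion_orthogonal.
Qed.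

End UpperBound.

(** * Polynomial positions of the vertices *)

Section Placement.
Variables (F : fieldType) (V : finType) (G : sgraph V) (d : nat).
Variables (V_ : 'I_d.+1 -> {set V}) (E_ : colour_pair d -> {set {set V}}).
Hypothesis part : @rigid_partition V G d V_ E_.

Implicit Types (w : 'rV[{poly F}]_d) (k : colour_pair d).

(* To leading order in ['X], the vector [w] is parallel to [direction F k]. *)
Definition leading_direction k w : Prop :=
  exists (m : nat) (g : 'rV[{poly F}]_d) (c : F),
    [/\ c != 0, w = 'X^m *: g & eval_mx 0 g = c *: direction F k].

Lemma leading_directionN k w : leading_direction k w -> leading_direction k (- w).
Proof.
move=> [m [g [c [c0 -> g0]]]]; exists m, (- g), (- c).
by rewrite oppr_eq0 scalerN map_mxN g0 scaleNr.
Qed.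

Lemma leading_directionX k w : leading_direction k w -> leading_direction k ('X *: w).
Proof.
move=> [m [g [c [c0 -> g0]]]]; exists m.+1, g, c; split=> //.
by rewrite scalerA exprS.
Qed.

Lemma eval0_perturb (x : 'rV[F]_d) w :
  eval_mx 0 (map_mx polyC x + 'X *: w) = x.
Proof.
by apply/matrixP => i j; rewrite !mxE horner_evalE hornerD hornerM hornerX mul0r
  hornerC addr0.
Qed.

Lemma leading_direction_perturb k w :
  leading_direction k (map_mx polyC (direction F k) + 'X *: w).
Proof.
exists 0%N, (map_mx polyC (direction F k) + 'X *: w), 1.
by rewrite oner_neq0 !scale1r eval0_perturb.
Qed.

(** A leading direction is demanded even of uncoloured pairs, so that distinct vertices get distinct
    positions for generic [t]. *)
Definition compatible (f : V -> 'rV[{poly F}]_d) (u v : V) : Prop :=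
  exists2 k, forall k', [set u; v] \in E_ k' -> k' = k &
    leading_direction k (f u - f v).

Lemma compatible_sym f u v : compatible f u v -> compatible f v u.
Proof.
move=> [k uvk kf]; exists k; first by rewrite setUC.
by rewrite -opprB; apply: leading_directionN.
Qed.

Lemma colour_unique e k k' : e \in E_ k -> e \in E_ k' -> k = k'.
Proof.
case: part => _ [disjE _] _ _ _ ek ek'; apply/eqP/negP => /negP kk'.
by have /disjoint_setI0/setP/(_ e) := disjE _ _ kk'; rewrite !inE ek ek'.
Qed.

Lemma place_class (U : {set V}) :
  (forall U' : {set V}, U' \subset U -> (2 <= #|U'|)%N -> @has_monochromatic_cut V G _ E_ U') ->
  exists f, {in U &, forall u v, u != v -> compatible f u v}.
Proof.
have [n] := ubnP #|U|; elim: n U => // n IHn U Un cutU.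
have [U1|U2] := leqP #|U| 1.
  by exists (fun=> 0) => u v uU vU; rewrite (card_le1_eqP U1 u v uU vU) eqxx.
have [A [B [A0 B0 AB AUB [k cutk]]]] := cutU U (subxx _) U2.
have cardAB : (#|A| + #|B| = #|U|)%N.
  by rewrite -AUB cardsU (disjoint_setI0 AB) cards0 subn0.
move: A0 B0; rewrite -!card_gt0 => A0 B0.
have subA : A \subset U by rewrite -AUB subsetUl.
have subB : B \subset U by rewrite -AUB subsetUr.
have [||fA fAP] := IHn A.
- by apply: (leq_trans (n := #|U|)); rewrite // -cardAB -[X in (X < _)%N]addn0 ltn_add2l.
- by move=> U' U'A; apply: cutU; apply: subset_trans subA.
have [||fB fBP] := IHn B.
- by apply: (leq_trans (n := #|U|)); rewrite // -cardAB -[X in (X < _)%N]add0n ltn_add2r.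
- by move=> U' U'B; apply: cutU; apply: subset_trans subB.
pose f u := if u \in A then map_mx polyC (direction F k) + 'X *: fA u else 'X *: fB u.
exists f.
have across u v : u \in A -> v \in B -> compatible f u v.
  move=> uA vB; exists k => [k' uvk'|].
    (* A coloured edge across the cut lies in the class of the cut, and classes are disjoint. *)
    apply: (colour_unique uvk'); apply: (subsetP cutk).
    rewrite inE; apply/andP; split; first by apply/bigcupP; exists k'.
    rewrite inE; case: part => _ [_ subE] _ _ _; apply/andP; split.
      by apply: (subsetP subE); apply/bigcupP; exists k'.
    by apply/exists_inP; exists u => //; apply/exists_inP; exists v.
  rewrite /f uA (disjointFl AB vB) -addrA -scalerBr.
  exact: leading_direction_perturb.
have inside h u v : compatible h u v -> f u - f v = 'X *: (h u - h v) ->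
    compatible f u v.
  by move=> [k' uvk' hk'] fh; exists k' => //; rewrite fh; apply: leading_directionX.
move=> u v; rewrite -AUB !inE => /orP[uA|uB] /orP[vA|vB] uv.
- apply: (inside fA); first exact: fAP.
  by rewrite /f uA vA scalerBr opprD addrACA subrr add0r.
- exact: across.
- exact/compatible_sym/across.
- apply: (inside fB); first exact: fBP.
  by rewrite /f (disjointFl AB uB) (disjointFl AB vB) scalerBr.
Qed.

Lemma placement :
  exists f : V -> 'rV[{poly F}]_d,
    (forall u v, u != v -> compatible f u v) /\
    (forall u i, u \in V_ i -> eval_mx 0 (f u) = simplex_vertex F i).
Proof.
case: (part) => -[disjV covV] _ endsE _ cutV.
have /fin_all_exists[cls clsP] u : exists i, u \in V_ i.
  by have /bigcupP[i _ ui] : u \in \bigcup_i V_ i; [rewrite covV inE | exists i].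
have clsE u i : u \in V_ i -> i = cls u.
  move=> ui; apply/eqP/negP => /negP icls.
  by have /disjoint_setI0/setP/(_ u) := disjV _ _ icls; rewrite !inE ui clsP.
have /fin_all_exists[h hP] i := place_class (cutV i).
pose f u := map_mx polyC (simplex_vertex F (cls u)) + 'X *: h (cls u) u.
exists f; split=> [|u i /clsE ->]; last by rewrite eval0_perturb.
have across u v : (cls u < cls v)%N -> compatible f u v.
  move=> uv; pose k : colour_pair d := exist _ (cls u, cls v) uv.
  (* Both classes must occur in the pair of [k']; as both pairs are increasing, [k' = k]. *)
  exists k => [k' /endsE/subsetP sub|].
    have : cls u \in [:: (val k').1; (val k').2].
      have /sub : u \in [set u; v] by rewrite !inE eqxx.
      by rewrite !inE => /orP[]/clsE->; rewrite eqxx ?orbT.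
    have : cls v \in [:: (val k').1; (val k').2].
      have /sub : v \in [set u; v] by rewrite !inE eqxx orbT.
      by rewrite !inE => /orP[]/clsE->; rewrite eqxx ?orbT.
    rewrite !inE => cv cu; apply: val_inj; case: k' cv cu {sub} => -[a b] /= ab.
    case/orP=> /eqP vE /orP[]/eqP uE; move: (uv); rewrite vE uE ?ltnn // => ba.
    by have := ltn_trans ab ba; rewrite ltnn.
  rewrite /f opprD addrACA -map_mxB -scalerBr.
  exact: (leading_direction_perturb k).
move=> u v uv; have [|/across/compatible_sym //|/val_inj cuv] := ltngtP (cls u) (cls v).
  exact: across.
have [|k uvk hk] := hP (cls u) u v (clsP u) _ uv; first by rewrite cuv.
exists k => //; rewrite /f -cuv opprD addrACA subrr add0r -scalerBr.
exact: leading_directionX.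
Qed.

End Placement.

(** * Choice of a generic t and comparison of the two bounds *)

Theorem theorem1p1 (R : realType) (d : nat) (V : finType) (G : sgraph V)
    (hd : (1 <= d)%N) (hV : (d + 1 <= #|V|)%N)
    (hP : exists (V_ : 'I_d.+1 -> {set V}) (E_ : colour_pair d -> {set {set V}}),
            @rigid_partition V G d V_ E_) :
  @d_rigid R d V G.
Proof.
have [V_ [E_ part]] := hP.
have [f [compf f0]] := placement R part.
pose p t v := eval_mx t (f v).
have sep u v : u != v -> near0 (fun t => p t u <> p t v).
  move=> /compf[k _ [m [g [c [c0 fuv g0]]]]].
  have /rV0Pn[j gj] : eval_mx 0 g != 0.
    by rewrite g0 scaler_eq0 negb_or c0 direction_neq0.
  (* A coordinate of [g] that is nonzero at 0 serves as the witness polynomial. *)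
  move: gj; rewrite !mxE horner_evalE => gj; exists (g 0 j) => // t t0 gt puv.
  have /matrixP/(_ 0 j) : eval_mx t (f u - f v) = 0.
    by rewrite map_mxB; apply/eqP; rewrite subr_eq0; apply/eqP.
  rewrite fuv !mxE horner_evalE hornerM hornerXn => /eqP.
  by rewrite mulf_eq0 expf_eq0 (negbTE t0) (negbTE gt) andbF.
have inj : near0 (fun t => injective (p t)).
  apply: (near0_imply (P := fun t => forall uv : V * V, uv.1 != uv.2 -> p t uv.1 <> p t uv.2)).
    move=> t _ pt u v puv; apply/eqP/negP => /negP uv; exact: (pt (u, v)).
  apply: near0_forall => -[u v] /=; case: (eqVneq u v) => [_|uv].
    by exists 1; rewrite ?hornerC ?oner_neq0.
  by apply: near0_imply (sep u v uv).
have /fin_all_exists[w wP] (e : 'I_#|edges G|) : exists w : 'rV[{poly R}]_(#|V| * d),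
    (forall t, t != 0 -> (eval_mx t w <= row e (rigidity_matrix G (p t)))%MS) /\
    (forall Y, eval_mx 0 w *m (mxvec Y)^T = 0 -> forall k u v,
      enum_val e = [set u; v] -> enum_val e \in E_ k ->
      (row (enum_rank u) Y - row (enum_rank v) Y) *m (direction R k)^T = 0).
  have /edges_card2/eqP/cards2P[u [v [uv euv]]] := enum_valP e.
  have [k0 uvk0 [m [g [c [c0 fuv g0]]]]] := compf _ _ uv.
  (* Replacing [f u - f v] by [g] divides the row by ['X^m]: harmless for [t != 0], and at 0 it
     leaves a nonzero multiple of [direction R k0]. *)
  exists (edge_row u v g); split=> [t t0|Y].
    rewrite rowK euv rigidity_row_pair // /p -map_mxB fuv map_mxZ edge_rowZ.
    rewrite map_edge_row eqmx_scale // [X in X != 0]hornerXn.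
    by rewrite expf_eq0 (negbTE t0) andbF.
  rewrite map_edge_row edge_row_dot g0 linearZ /= -scalemxAr => /eqP.
  rewrite scaler_eq0 (negbTE c0) /= => /eqP orth k x y.
  rewrite euv => exy /uvk0 ->.
  have : x \in [set u; v] by rewrite exy !inE eqxx.
  have : y \in [set u; v] by rewrite exy !inE eqxx orbT.
  rewrite !inE => /orP[]/eqP-> /orP[]/eqP->; rewrite ?subrr ?mul0mx //.
  by rewrite -opprB mulNmx orth oppr0.
pose W := \matrix_e w e.
have [t t0 [injt [rkW rkM]]] := near0_exists
  (near0_and inj (near0_and (near0_rank W) (near0_rank (motions f)))).
exists (p t) => //.
have lower : (#|V| * d <= \rank (eval_mx 0 W) + #|{: colour_pair d}|)%N.
  apply: (rank_limit_rows part) => Y WY k u v uvk.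
  have uvG : [set u; v] \in edges G.
    by case: part => _ [_ /subsetP sub] _ _ _; apply: sub; apply/bigcupP; exists k.
  pose e := enum_rank_in uvG [set u; v].
  have wY : eval_mx 0 (w e) *m (mxvec Y)^T = 0.
    by have /(congr1 (row e)) := WY; rewrite row_mul row0 -map_row rowK.
  have [_ /(_ Y wY)] := wP e; rewrite enum_rankK_in //; exact.
have sub : (eval_mx t W <= rigidity_matrix G (p t))%MS.
  apply/row_subP => e; rewrite -map_row rowK.
  by have [wt _] := wP e; apply: submx_trans (wt t t0) (row_sub _ _).
(* At 0 each vertex sits at the simplex vertex of its class, and connected graphs are nonempty, so
   every simplex edge has an occupied end. *)
have rkM0 : \rank (eval_mx 0 (motions f)) = #|{: colour_pair d}|.
  case: (part) => _ _ _ conn _.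
  have /fin_all_exists[r rP] (k : colour_pair d) : exists v, v \in V_ (val k).1 :|: V_ (val k).2.
    by have [/set0Pn] := conn k.
  rewrite map_motions; apply: (rank_motions (r := r)) => k.
  have := rP k; rewrite inE => /orP[]/f0 rk.
    by exists (val k).1; rewrite ?inE ?eqxx.
  by exists (val k).2; rewrite ?inE ?eqxx ?orbT.
have upper := rank_rigidity_motions G (p t).
rewrite rkM0 map_motions in rkM.
apply/eqP; rewrite -card_colour_pair (mulnC d) eqn_leq; apply/andP; split.
  (* The side condition, that the subtraction is not truncated, follows from the independence of the
     motions at [t]. *)
  rewrite leq_subRL ?[(\rank _ + _)%N]addnC.
    by apply: leq_trans upper; rewrite addnC leq_add2l.
  by apply: leq_trans rkM _; apply: leq_trans upper; rewrite leq_addl.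
rewrite leq_subLR addnC; apply: leq_trans lower _; rewrite leq_add2r.
exact: leq_trans rkW (mxrankS sub).
Qed.
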